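(* Let $G$ be a countable discrete FC-group. Then, for every $m\in\mathbb{N}$, $m\geq1$, the family $$\mathcal{W}=\{A\subseteq G^m : A \text{ is a left piecewise syndetic set}\}$$ has the right van der Waerden property in $G^m$. That is, $G$ is both a right and a left van der Waerden group.
   Context: An FC-group is a group all of whose conjugacy classes are finite. Largeness in a group $H$. $S\subseteq H$ is right syndetic if $H=\bigcup_{h\in F}h^{-1}S$ for some finite $F\subseteq H$, and left syndetic if $H=\bigcup_{h\in F}Sh^{-1}$ for some finite $F\subseteq H$. $T\subseteq H$ is right thick if for every finite $F\subseteq H$ there is $x\in H$ with $Fx\subseteq T$, and left thick if for every finite $F\subseteq H$ there is $x\in H$ with $xF\subseteq T$. $A\subseteq H$ is left piecewise syndetic if $\bigcup_{h\in F}Ah^{-1}$ is left thick for some finite $F\subseteq H$. Van der Waerden property. A nonempty family $\mathcal{W}$ of subsets of $H$ with $\emptyset\notin\mathcal{W}$ has the almost right van der Waerden property if for each $A\in\mathcal{W}$ at least one of the following holds: (i) there is a right syndetic $S\subseteq H$ with $\bigcap_{f\in F}Af^{-1}\in\mathcal{W}$ for all finite nonempty $F\subseteq S$; (ii) there is a left thick $T\subseteq H$ with $\bigcap_{f\in F}Af^{-1}\in\mathcal{W}$ for all finite nonempty $F\subseteq T$. It has the right van der Waerden property if in addition it is partition regular (whenever $A\in\mathcal{W}$ is a finite union $A=A_1\cup\dots\cup A_n$, some $A_i\in\mathcal{W}$) and closed under right translation ($A\in\mathcal{W}$, $x\in H$ imply $Ax\in\mathcal{W}$). The left van der Waerden property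 is the mirror image: ''right syndetic'' is replaced by ''left syndetic'', ''left thick'' by ''right thick'', $Af^{-1}$ by $f^{-1}A$, and right translation by left translation. A countable, discrete, amenable group $G$ is a right (resp. left) van der Waerden group if for every $m\in\mathbb{N}$ the group $G^m$ possesses a family of subsets with the right (resp. left) van der Waerden property. A countable group is amenable iff it has a right Følner sequence, i.e. a sequence $(\Phi_n)$ of finite nonempty subsets with $\lim_n|\Phi_n\cap\Phi_ng|/|\Phi_n|=1$ for all $g$. *)

(* Defs.v *)
From HB Require Import structures.
From mathcomp Require Import all_boot all_order all_algebra.
From mathcomp Require Import finmap.
From mathcomp Require Import mathcomp_extra boolp classical_sets functions.
From mathcomp Require Import cardinality reals topology normedtype sequences.

Set Implicit Arguments.
Unset Strict Implicit.
Unset Printing Implicit Defensive.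

Import Order.TTheory GRing.Theory Num.Theory.
Import numFieldNormedType.Exports.

Local Open Scope classical_set_scope.
Local Open Scope ring_scope.

Definition FC_group (G : groupType) : Prop :=
  forall g : G, finite_set [set (g ^ x)%g | x in [set: G]].

(* [ltrans x A] is xA and [rtrans A x] is Ax. *)
Definition ltrans (H : groupType) (x : H) (A : set H) : set H :=
  [set (x * a)%g | a in A].

Definition rtrans (H : groupType) (A : set H) (x : H) : set H :=
  [set (a * x)%g | a in A].

Section Largeness.
Variable H : groupType.
Implicit Types S T A : set H.

Definition right_syndetic S : Prop :=
  exists2 F : set H, finite_set F &
    [set: H] = \bigcup_(h in F) ltrans h^-1%g S.

Definition left_syndetic S : Prop :=
  exists2 F : set H, finite_set F &
    [set: H] = \bigcup_(h in F) rtrans S h^-1%g.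

Definition right_thick T : Prop :=
  forall F : set H, finite_set F -> exists x : H, rtrans F x `<=` T.

Definition left_thick T : Prop :=
  forall F : set H, finite_set F -> exists x : H, ltrans x F `<=` T.

Definition left_piecewise_syndetic A : Prop :=
  exists2 F : set H, finite_set F &
    left_thick (\bigcup_(h in F) rtrans A h^-1%g).

End Largeness.

Section VanDerWaerden.
Variable H : groupType.
Implicit Types W : set (set H).

Definition almost_right_vdW W : Prop :=
  [/\ W !=set0, ~ W set0 &
    forall A, W A ->
      (exists2 S, right_syndetic S &
         forall F, finite_set F -> F !=set0 -> F `<=` S ->
           W (\bigcap_(f in F) rtrans A f^-1%g)) \/
      (exists2 T, left_thick T &
         forall F, finite_set F -> F !=set0 -> F `<=` T ->
           W (\bigcap_(f in F) rtrans A f^-1%g))].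

Definition almost_left_vdW W : Prop :=
  [/\ W !=set0, ~ W set0 &
    forall A, W A ->
      (exists2 S, left_syndetic S &
         forall F, finite_set F -> F !=set0 -> F `<=` S ->
           W (\bigcap_(f in F) ltrans f^-1%g A)) \/
      (exists2 T, right_thick T &
         forall F, finite_set F -> F !=set0 -> F `<=` T ->
           W (\bigcap_(f in F) ltrans f^-1%g A))].

Definition partition_regular W : Prop :=
  forall (A : set H) (n : nat) (B : 'I_n -> set H),
    W A -> A = \bigcup_(i in [set: 'I_n]) B i -> exists i, W (B i).

Definition right_vdW W : Prop :=
  [/\ almost_right_vdW W, partition_regular W &
    forall A x, W A -> W (rtrans A x)].

Definition left_vdW W : Prop :=
  [/\ almost_left_vdW W, partition_regular W &
    forall A x, W A -> W (ltrans x A)].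

End VanDerWaerden.

Definition right_Folner (R : realType) (G : groupType)
    (Phi : nat -> {fset G}) : Prop :=
  (forall n, Phi n != fset0) /\
  forall g : G,
    (#|` (Phi n `&` [fset (x * g)%g | x in Phi n])%fset |%:R
       / #|` Phi n|%:R : R) @[n --> \oo] --> (1 : R).

(* For countable groups, amenability is the existence of a right Folner
   sequence; the real field R only serves to express the limit. *)
Definition amenable (R : realType) (G : groupType) : Prop :=
  exists Phi : nat -> {fset G}, right_Folner R Phi.

(* The power G^m is {ffun 'I_m -> G} with its pointwise group structure. *)
Definition right_vdW_group (R : realType) (G : groupType) : Prop :=
  [/\ countable [set: G], amenable R G &
    forall m : nat, exists W : set (set {ffun 'I_m -> G}), right_vdW W].

Definition left_vdW_group (R : realType) (G : groupType) : Prop :=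
  [/\ countable [set: G], amenable R G &
    forall m : nat, exists W : set (set {ffun 'I_m -> G}), left_vdW W].

(* Main.v *)
(* A set is left piecewise syndetic iff it belongs to an ultrafilter p of a
   minimal closed right-invariant subset of the Stone-Cech compactification,
   i.e. an ultrafilter containing some maximal proper right-invariant filter.
   For A in p, the set of return times {f | A f^-1 in p} is left syndetic by
   minimality, and finite intersections of the A f^-1 stay in p. In an FC-group
   left syndetic sets are right syndetic: replace the finite set of translates
   by its conjugation closure. Inversion exchanges left and right.

   For amenability, let K be a finite conjugation-invariant set containing 1.
   Since x y = y x^y, every word in K can be sorted without changing its length
   or its product, so |K^n| is polynomially bounded and hence
   |K^(n+1)| <= (1 + e) |K^n| for some n; this K^n is almost invariant under
   K. *)
Require Import Defs.
From HB Require Import structures.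
From mathcomp Require Import all_boot all_order all_algebra.
From mathcomp Require Import finmap.
From mathcomp Require Import mathcomp_extra boolp classical_sets functions.
From mathcomp Require Import cardinality reals topology normedtype sequences.

Set Implicit Arguments.
Unset Strict Implicit.
Unset Printing Implicit Defensive.

Local Open Scope classical_set_scope.

(** * Translates and syndetic sets, described pointwise *)

Section Translates.
Variable H : groupType.
Implicit Types (A S T : set H) (g x y : H).

Lemma rtransP A x y : rtrans A x y <-> A (y * x^-1)%g.
Proof.
split=> [[a Aa <-]|Ayx]; first by rewrite mulgK.
by exists (y * x^-1)%g; rewrite ?mulgVK.
Qed.

Lemma rtransVP A x y : rtrans A x^-1%g y <-> A (y * x)%g.
Proof. by rewrite rtransP invgK. Qed.

Lemma ltransP A x y : ltrans x A y <-> A (x^-1 * y)%g.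
Proof.
split=> [[a Aa <-]|Axy]; first by rewrite mulKg.
by exists (x^-1 * y)%g; rewrite ?mulVKg.
Qed.

Lemma ltransVP A x y : ltrans x^-1%g A y <-> A (x * y)%g.
Proof. by rewrite ltransP invgK. Qed.

Lemma right_syndeticP S :
  right_syndetic S <->
  exists2 F : set H, finite_set F & forall g, exists2 h, F h & S (h * g)%g.
Proof.
split=> -[F finF HF]; exists F => //.
  move=> g; have : [set: H] g by [].
  by rewrite HF => -[h Fh /ltransVP]; exists h.
apply/esym/seteqP; split=> // g _; have [h Fh Sh] := HF g.
by exists h => //; apply/ltransVP.
Qed.

Lemma left_syndeticP S :
  left_syndetic S <->
  exists2 F : set H, finite_set F & forall g, exists2 h, F h & S (g * h)%g.
Proof.
split=> -[F finF HF]; exists F => //.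
  move=> g; have : [set: H] g by [].
  by rewrite HF => -[h Fh /rtransVP]; exists h.
apply/esym/seteqP; split=> // g _; have [h Fh Sh] := HF g.
by exists h => //; apply/rtransVP.
Qed.

End Translates.

(** * Minimal ultrafilters and left piecewise syndetic sets *)

Section MinimalUltrafilters.
Variable H : groupType.
Implicit Types (A B C E S T : set H) (F p : set_system H).

Definition right_invariant F := forall A g, F A -> F (rtrans A g).

(* An ultrafilter lying in a minimal closed right-invariant subset of the
   Stone-Cech compactification of H; F is the filter of that subset. *)
Definition minimal_ultrafilter p := exists F,
  [/\ ProperFilter F, right_invariant F, UltraFilter p, F `<=` p &
    forall A, p A -> exists2 E, finite_set E & F (\bigcup_(h in E) rtrans A h^-1%g)].

(** The filter generated by [F] and all right translates of [B]. *)
Definition invariant_adjoin F B : set_system H :=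
  [set C | exists2 A, F A & exists2 E, finite_set E &
     A `&` \bigcap_(h in E) rtrans B h^-1%g `<=` C].

Lemma sub_invariant_adjoin F B : F `<=` invariant_adjoin F B.
Proof. by move=> A FA; exists A => //; exists set0 => // x []. Qed.

Lemma mem_invariant_adjoin F B : Filter F -> invariant_adjoin F B B.
Proof.
move=> FF; exists setT; first exact: filterT.
exists [set 1%g]; first exact: finite_set1.
by move=> x [_ /(_ 1%g erefl)/rtransVP]; rewrite mulg1.
Qed.

Lemma invariant_adjoin_filter F B : Filter F -> Filter (invariant_adjoin F B).
Proof.
move=> FF; split.
- by apply: sub_invariant_adjoin; exact: filterT.
- move=> P Q [A FA [D finD DP]] [A' FA' [E finE EQ]].
  exists (A `&` A'); first exact: filterI.
  exists (D `|` E); first by rewrite finite_setU.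
  move=> x [[Ax A'x] DEx]; split.
    by apply: DP; split=> // h Dh; apply: DEx; left.
  by apply: EQ; split=> // h Eh; apply: DEx; right.
- move=> P Q PQ [A FA [D finD DP]]; exists A => //; exists D => //.
  exact: subset_trans PQ.
Qed.

Lemma invariant_adjoin_invariant F B :
  right_invariant F -> right_invariant (invariant_adjoin F B).
Proof.
move=> invF C g [A FA [E finE EC]]; exists (rtrans A g); first exact: invF.
exists [set (g^-1 * h)%g | h in E]; first exact: finite_image.
move=> x [/rtransP Ax BEx]; apply/rtransP/EC; split=> // h Eh.
have /rtransVP Bx : rtrans B (g^-1 * h)^-1%g x by apply: BEx; exists h.
by apply/rtransVP; rewrite -mulgA.
Qed.

Lemma invariant_adjoin_proper F B : Filter F ->
    (forall A E, F A -> finite_set E ->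
       A `&` \bigcap_(h in E) rtrans B h^-1%g !=set0) ->
  ProperFilter (invariant_adjoin F B).
Proof.
move=> FF FB; apply: Build_ProperFilter_ex; last exact: invariant_adjoin_filter.
by move=> C [A FA [E finE EC]]; have [x ABx] := FB _ _ FA finE; exists x; apply: EC.
Qed.

(** Thickness says that any finitely many translates [B h^-1] have a common point, so [B] lies in a
    proper right-invariant filter; Zorn's lemma then gives a maximal one. *)
Lemma maximal_invariant_filter B : left_thick B -> exists F,
  [/\ ProperFilter F, right_invariant F, F B &
    forall F', ProperFilter F' -> right_invariant F' -> F `<=` F' -> F' `<=` F].
Proof.
move=> thB; pose good F := [/\ ProperFilter F, right_invariant F & F B].
(* Zorn_bigcup also asks for the union of the empty chain. *)
pose P F := F = set0 \/ good F.
have [|F [PF Fmax]] := @Zorn_bigcup _ P.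
  move=> K KP totK; have [[F0 KF0 F0n0]|K0] := pselect (exists2 F, K F & F <> set0); last first.
    left; apply/seteqP; split=> // A [F KF FA].
    have [F_0|Fn0] := pselect (F = set0); first by rewrite F_0 in FA.
    by case: K0; exists F.
  have Kgood F A : K F -> F A -> good F.
    by move=> KF FA; have [F_0|//] := KP _ KF; rewrite F_0 in FA.
  have [F00//|[F0p F0inv F0B]] := KP _ KF0.
  right; split; last by exists F0.
    apply: Build_ProperFilter_ex.
      move=> A [F KF FA]; have [pF _ _] := Kgood _ _ KF FA.
      exact: filter_ex FA.
    split.
    - by exists F0 => //; exact: filterT.
    - move=> A C [F KF FA] [F' KF' F'C].
      have [pF _ _] := Kgood _ _ KF FA; have [pF' _ _] := Kgood _ _ KF' F'C.
      have [FF'|F'F] := totK _ _ KF KF'.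
        by exists F' => //; apply: filterI => //; exact: FF'.
      by exists F => //; apply: filterI => //; exact: F'F.
    - move=> A C AC [F KF FA]; have [pF _ _] := Kgood _ _ KF FA.
      by exists F => //; exact: filterS FA.
  move=> A g [F KF FA]; have [_ iF _] := Kgood _ _ KF FA.
  by exists F => //; exact: iF.
have [F_0|[pF iF FB]] := PF.
  have triv : Filter [set [set: H]].
    split=> //= [C D -> ->|C D CD C_T]; first by rewrite setIT.
    by apply/seteqP; split=> // x _; apply: CD; rewrite C_T.
  case: (Fmax (invariant_adjoin [set [set: H]] B)).
    rewrite F_0; split=> //; move=> /(_ B) abs.
    by case: abs; exact: mem_invariant_adjoin.
  right; split.
  - apply: invariant_adjoin_proper => A E -> finE.
    have [x xE] := thB E finE; exists x; split=> // h Eh.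
    by apply/rtransVP/xE; exists h.
  - apply: invariant_adjoin_invariant => A g ->.
    by apply/seteqP; split=> // x _; apply/rtransP.
  - exact: mem_invariant_adjoin.
exists F; split=> // F' pF' iF' FF'.
apply: contrapT => nF'F; apply: (Fmax F'); first by split.
by right; split=> //; exact: FF'.
Qed.

Lemma ultra_bigcup p (I : choiceType) (D : set I) (A : I -> set H) :
    UltraFilter p -> finite_set D -> p (\bigcup_(i in D) A i) ->
  exists2 i, D i & p (A i).
Proof.
move=> up /finite_fsetP[X ->] pA; apply: contrapT => nA.
have pC : p (\bigcap_(i in [set` X]) ~` A i).
  apply: filter_bigI => i Xi.
  by have [pAi|//] := in_ultra_setVsetC (A i) up; case: nA; exists i.
have [x [[i Xi Aix] Cx]] := filter_ex (filterI pA pC).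
exact: (Cx i Xi).
Qed.

(** By invariance, finitely many translates of the union given by minimality still meet; a common
    point is the [x] required by thickness. *)
Lemma minimal_ultrafilter_left_pws p A :
  minimal_ultrafilter p -> p A -> left_piecewise_syndetic A.
Proof.
move=> [F [pF invF _ _ Fp]] /Fp[E finE FE]; exists E => // D /finite_fsetP[X ->].
have : F (\bigcap_(g in [set` X]) rtrans (\bigcup_(h in E) rtrans A h^-1%g) g^-1%g).
  by apply: filter_bigI => g _; exact: invF.
move=> /filter_ex[x xX]; exists x => _ [g Xg <-].
by have /rtransVP := xX g Xg.
Qed.

Lemma left_pws_minimal_ultrafilter A :
  left_piecewise_syndetic A -> exists2 p, minimal_ultrafilter p & p A.
Proof.
move=> [E finE /maximal_invariant_filter[F [pF iF FE Fmax]]].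
have meetF C : (forall D, F D -> D `&` C !=set0) ->
    exists2 E', finite_set E' & F (\bigcup_(h in E') rtrans C h^-1%g).
  move=> FC; apply: contrapT => nE'.
  have FnC : F (~` C).
    apply: (Fmax (invariant_adjoin F (~` C))).
    - apply: invariant_adjoin_proper => D D' FD finD'; apply: contrapT => nD.
      apply: nE'; exists D' => //; apply: filterS FD => x Dx.
      apply: contrapT => nx; apply: nD; exists x; split=> // h D'h.
      by apply/rtransVP => Cx; apply: nx; exists h => //; apply/rtransVP.
    - exact: invariant_adjoin_invariant.
    - exact: sub_invariant_adjoin.
    - exact: mem_invariant_adjoin.
  by have [x []] := FC _ FnC.
(* An ultrafilter above [F] contains some [A h^-1] with [h] in [E], and also [D h^-1]; a common
   point [x] gives [x h] in both [D] and [A]. *)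
have FA D : F D -> D `&` A !=set0.
  have [q [uq Fq]] := ultraFilterLemma pF.
  have [h Eh qh] := ultra_bigcup uq finE (Fq _ FE).
  move=> FD; have [x [/rtransVP Dx /rtransVP Ax]] :=
    filter_ex (filterI (Fq _ (iF _ h^-1%g FD)) qh).
  by exists (x * h)%g.
have pFA : ProperFilter (within A F).
  apply: Build_ProperFilter_ex => C /FA[x [Cx Ax]]; exists x; exact: Cx.
have [p [up Fp]] := ultraFilterLemma pFA.
have sFp : F `<=` p by move=> C FC; apply: Fp; rewrite /within /=; apply: filterS FC.
exists p; last by apply: Fp; exact: withinT.
exists F; split=> // C pC; apply: meetF => D FD.
exact: filter_ex (filterI (sFp _ FD) pC).
Qed.

(** Invariance shifts the union of the [A h^-1] to that of the [A (g h)^-1], which is still in [p];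
    so some [g h] with [h] in the fixed set [E] is a return time. *)
Lemma minimal_ultrafilter_return p A : minimal_ultrafilter p -> p A ->
  left_syndetic [set f | p (rtrans A f^-1%g)].
Proof.
move=> [F [pF iF up sFp Fp]] /Fp[E finE FE]; apply/left_syndeticP.
exists E => // g; have pE : p (\bigcup_(h in E) rtrans A (g * h)^-1%g).
  apply: filterS (sFp _ (iF _ g^-1%g FE)) => x /rtransVP[h Eh /rtransVP Ax].
  by exists h => //; apply/rtransVP; rewrite mulgA.
exact: ultra_bigcup up finE pE.
Qed.

End MinimalUltrafilters.

Lemma left_pws_partition_regular (H : groupType) :
  partition_regular [set A : set H | left_piecewise_syndetic A].
Proof.
move=> A n B /left_pws_minimal_ultrafilter[p mp pA] AB.
have [_ [_ _ up _ _]] := mp; rewrite AB in pA.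
have [i _ pBi] := ultra_bigcup up finite_finset pA.
by exists i; exact: minimal_ultrafilter_left_pws mp pBi.
Qed.

Lemma left_pws_rtrans (H : groupType) (A : set H) x :
  left_piecewise_syndetic A -> left_piecewise_syndetic (rtrans A x).
Proof.
move=> [E finE thE]; exists [set (h * x)%g | h in E]; first exact: finite_image.
move=> D /thE[y yD]; exists y; apply: subset_trans yD _ => z [h Eh /rtransVP Az].
exists (h * x)%g; first by exists h.
by apply/rtransVP/rtransP; rewrite mulgA mulgK.
Qed.

(** * The right van der Waerden property in FC-groups, and their powers *)

Section FCGroups.
Variable H : groupType.
Hypothesis H_FC : FC_group H.

Lemma FC_conj_closure (F : set H) : finite_set F -> exists2 E : set H,
  finite_set E & F `<=` E /\ forall g x, E g -> E (g ^ x)%g.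
Proof.
move=> finF; exists (\bigcup_(g in F) [set (g ^ x)%g | x in [set: H]]).
  by apply: bigcup_finite => // g _; exact: H_FC.
split=> [g Fg|_ x [g Fg [y _ <-]]]; first by exists g => //; exists 1%g; rewrite ?conjg1.
by exists g => //; exists (y * x)%g; rewrite ?conjgM.
Qed.

Lemma FC_left_right_syndetic (S : set H) : left_syndetic S -> right_syndetic S.
Proof.
move=> /left_syndeticP[F /FC_conj_closure[E finE [FE EJ]] SF].
apply/right_syndeticP; exists E => // g; have [h Fh Sgh] := SF g.
(* [g h = (h ^ g^-1) g] moves the translating element to the left. *)
by exists (h ^ g^-1)%g; [exact/EJ/FE|rewrite -conjgCV].
Qed.

Theorem FC_left_pws_right_vdW :
  right_vdW [set A : set H | left_piecewise_syndetic A].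
Proof.
split; [split|exact: left_pws_partition_regular|exact: left_pws_rtrans].
- exists setT; exists [set 1%g]; first exact: finite_set1.
  by move=> D _; exists 1%g => y _; exists 1%g => //; apply/rtransVP.
- move=> [E _ /(_ [set 1%g] (finite_set1 _))[x]].
  by move=> /(_ (x * 1)%g)[|h _ /rtransVP//]; exists 1%g.
- move=> A /left_pws_minimal_ultrafilter[p mp pA]; left.
  exists [set f | p (rtrans A f^-1%g)].
    exact/FC_left_right_syndetic/minimal_ultrafilter_return.
  move=> F /finite_fsetP[X ->] _ XS; apply: (minimal_ultrafilter_left_pws mp).
  by have [_ [_ _ up _ _]] := mp; apply: filter_bigI => f; exact: XS.
Qed.

End FCGroups.

(** Every conjugate of [f] takes its values in the finite union [X] of the classes of the [f i], and
    there are finitely many maps from [I] to [X]. *)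
Lemma FC_ffun (I : finType) (G : groupType) :
  FC_group G -> FC_group {ffun I -> G}.
Proof.
move=> G_FC f.
have /finite_fsetP[X defX] :
    finite_set (\bigcup_(i in [set: I]) [set (f i ^ x)%g | x in [set: G]]).
  by apply: bigcup_finite => // i _; exact: G_FC.
apply: (@sub_finite_set _ _
  (range (fun h : {ffun I -> X} => [ffun i => val (h i)]))); last first.
  exact/finite_image/finite_finset.
move=> _ [x _ <-].
have Xf i : (f ^ x)%g i \in X.
  have : [set` X] ((f ^ x)%g i); last by [].
  by rewrite -defX; exists i => //; exists (x i) => //; rewrite !ffunE.
by exists [ffun i => [` Xf i]%fset] => //; apply/ffunP => i; rewrite !ffunE.
Qed.

(** * Passing from right to left by inversion *)

Section Mirror.
Variable H : groupType.
Implicit Types (A S T : set H) (W : set (set H)).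

Definition setV A : set H := [set x | A x^-1%g].

Lemma setVK : involutive setV.
Proof. by move=> A; apply/seteqP; split=> x; rewrite /setV /= invgK. Qed.

Lemma setV_ltrans x A : setV (ltrans x A) = rtrans (setV A) x^-1%g.
Proof.
apply/seteqP; split=> y; rewrite /setV.
  by move=> /ltransP Ay; apply/rtransVP; rewrite /= invgM.
by move=> /rtransVP /=; rewrite invgM => Ay; apply/ltransP.
Qed.

Lemma finite_setV A : finite_set A -> finite_set (setV A).
Proof.
move=> finA; apply: sub_finite_set (finite_image (fun x => x^-1%g) finA) => x Ax.
by exists x^-1%g; rewrite ?invgK.
Qed.

Lemma setV_syndetic S : right_syndetic S -> left_syndetic (setV S).
Proof.
move=> /right_syndeticP[F finF FS]; apply/left_syndeticP.
exists (setV F); first exact: finite_setV.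
move=> g; have [h Fh Sh] := FS g^-1%g.
by exists h^-1%g; rewrite /setV /= ?invgM invgK.
Qed.

Lemma setV_thick T : left_thick T -> right_thick (setV T).
Proof.
move=> thT F /finite_setV/thT[x xT]; exists x^-1%g => _ [f Ff <-].
by rewrite /setV /= invgM invgK; apply: xT; exists f^-1%g; rewrite /setV /= ?invgK.
Qed.

Lemma setV_left_vdW W : right_vdW W -> left_vdW (setV @^-1` W).
Proof.
move=> [[[A0 WA0] W0 Wcap] Wreg Wtrans].
(* Shared by both alternatives: inversion turns the intersection over [F] into one over [setV F],
   which lies in [S]. *)
have capV A S F : F `<=` setV S -> F !=set0 -> finite_set F ->
    (forall F', finite_set F' -> F' !=set0 -> F' `<=` S ->
      W (\bigcap_(f in F') rtrans (setV A) f^-1%g)) ->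
    W (setV (\bigcap_(f in F) ltrans f^-1%g A)).
  move=> FS [f0 Ff0] finF WF.
  suff -> : setV (\bigcap_(f in F) ltrans f^-1%g A) =
      \bigcap_(f in setV F) rtrans (setV A) f^-1%g.
    apply: WF; first exact: finite_setV.
      by exists f0^-1%g; rewrite /setV /= invgK.
    by move=> f /FS; rewrite /setV /= invgK.
  apply/seteqP; split=> x xF f Ff.
    by have := xF _ Ff; rewrite -[ltrans _ _ _]/(setV (ltrans _ _) x) setV_ltrans invgK.
  have := xF f^-1%g; rewrite /setV /= invgK => /(_ Ff).
  by rewrite -[ltrans _ _ _]/(setV (ltrans _ _) x) setV_ltrans invgK.
split; [split| |].
- by exists (setV A0); rewrite /preimage /= setVK.
- by move=> WV0; apply: W0; congr W: WV0; apply/seteqP; split.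
- move=> A /Wcap[[S synS WS]|[T thT WT]]; [left|right].
    exists (setV S); first exact: setV_syndetic.
    by move=> F finF F0 FS; exact: capV WS.
  exists (setV T); first exact: setV_thick.
  by move=> F finF F0 FT; exact: capV WT.
- by move=> A n B WA AB; apply: (Wreg _ n (fun i => setV (B i)) WA); rewrite AB.
- by move=> A x WA; rewrite /preimage /= setV_ltrans; exact: Wtrans.
Qed.

End Mirror.

(** * Polynomial growth of words in a conjugation-invariant alphabet *)

Section WordGrowth.
Variables (G : groupType) (r : nat) (k : 'I_r.+1 -> G).
Hypothesis kJ : forall i j, exists l, k l = (k i ^ k j)%g.

Definition word_prod (s : seq 'I_r.+1) : G := (\prod_(i <- s) k i)%g.

Lemma word_prod_cons i s : word_prod (i :: s) = (k i * word_prod s)%g.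
Proof. exact: big_cons. Qed.

Lemma word_prod_rcons s i : word_prod (rcons s i) = (word_prod s * k i)%g.
Proof. by rewrite /word_prod -cats1 big_cat big_seq1. Qed.

(* An inversion i > j is removed by [k i * k j = k j * (k i ^ k j)], which
   lowers the first letter. *)
Lemma sorted_word n s : size s = n -> exists t,
  [/\ size t = n, sorted leq (map val t) & word_prod t = word_prod s].
Proof.
elim: n s => [|n IHn] [|i s] //= => [_|[sz_s]]; first by exists [::].
have [m] := ubnP (i : nat); elim: m i s sz_s => // m IHm i s sz_s ltim.
have [[|j u] [sz_t sort_t def_t]] := IHn s sz_s.
  by exists [:: i]; rewrite !word_prod_cons -def_t -sz_t.
have [leij|ltji] := leqP i j.
  exists (i :: j :: u); split=> /=; first by rewrite -sz_t.
    by rewrite leij.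
  by rewrite !word_prod_cons -def_t word_prod_cons.
have [l def_l] := kJ i j.
have [||t' [sz_t' sort_t' def_t']] := IHm j (l :: u).
- by rewrite /= -sz_t.
- exact: leq_trans ltji ltim.
exists t'; split=> //; rewrite def_t' !word_prod_cons -def_t word_prod_cons.
by rewrite def_l mulgA -conjgC mulgA.
Qed.

Definition words_of_length n : {fset G} :=
  [fset word_prod (val t) | t : n.-tuple 'I_r.+1]%fset.

Lemma words_of_lengthP n g : reflect
  (exists2 s, size s = n & g = word_prod s) (g \in words_of_length n).
Proof.
apply: (iffP (imfsetP _ _ _ _)) => [[t _ ->]|[s sz_s ->]].
  by exists t; rewrite ?size_tuple.
by exists (Tuple (introT eqP sz_s)).
Qed.

(** Sorted words already give all products. There are ['C(n + r, r)] of them, at most the falling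
    factorial of [n + r] with [r] factors. *)
Lemma leq_card_words n : #|` words_of_length n| <= (n + r) ^ r.
Proof.
pose sortedT := [set t : n.-tuple 'I_r.+1 | sorted leq (map val t)]%SET.
have sub : (words_of_length n `<=` [fset word_prod (val t) | t in sortedT])%fset.
  apply/fsubsetP => _ /words_of_lengthP[s /sorted_word[t [sz_t st <-]] ->].
  apply/imfsetP; exists (Tuple (introT eqP sz_t)) => //=.
  by rewrite inE.
apply: leq_trans (fsubset_leq_card sub) _.
apply: (@leq_trans #|sortedT|); first by rewrite cardE; exact: leq_imfset_card.
rewrite card_sorted_tuples.
rewrite -bin_sub ?leq_addr// addKn.
have : 'C(n + r, r) * r`! <= (n + r) ^ r.
  rewrite bin_ffact ffact_prod -[X in _ ^ X]card_ord -prod_nat_const.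
  by apply: leq_prod => i _; exact: leq_subr.
by apply: leq_trans; rewrite leq_pmulr// fact_gt0.
Qed.

Lemma words_of_lengthMr n g i :
  g \in words_of_length n -> (g * k i)%g \in words_of_length n.+1.
Proof.
move=> /words_of_lengthP[s sz_s ->]; apply/words_of_lengthP.
by exists (rcons s i); rewrite ?size_rcons ?sz_s ?word_prod_rcons.
Qed.

Lemma words_of_length_neq0 n : words_of_length n != fset0.
Proof.
apply/fset0Pn; exists (word_prod (nseq n ord0)); apply/words_of_lengthP.
by exists (nseq n ord0); rewrite ?size_nseq.
Qed.

End WordGrowth.

Import Order.TTheory GRing.Theory Num.Theory.
Import numFieldNormedType.Exports.
Local Open Scope ring_scope.

(** * Polynomially bounded sequences have steps of small ratio *)

Section SubexponentialGrowth.
Variable R : realType.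

Lemma bernoulli (e : R) n : 0 <= e -> 1 + e *+ n <= (1 + e) ^+ n.
Proof.
move=> e0; elim: n => [|n IHn]; first by rewrite mulr0n addr0.
rewrite exprS mulrDl mul1r mulrSr addrA lerD// ler_peMr// exprn_ege1//.
by rewrite lerDl.
Qed.

(* With n = (d+1)m, Bernoulli gives (1+e)^n >= (me)^(d+1), which beats the
   polynomial bound ((2d+1)m)^d. *)
Lemma polynomial_growth_ratio (d : nat) (a : nat -> nat) (e : R) : 0 < e ->
    (0 < a 0)%N -> (forall n, a n <= (n + d) ^ d)%N ->
  exists n, (a n.+1)%:R <= (1 + e) * (a n)%:R.
Proof.
move=> e0 a0 ad; apply: contrapT => nex.
have grow n : (1 + e) ^+ n <= (a n)%:R.
  elim: n => [|n IHn]; first by rewrite expr0 ler1n.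
  apply: (@le_trans _ _ ((1 + e) * (a n)%:R)).
    by rewrite exprS ler_wpM2l// addr_ge0// ltW.
  by rewrite leNgt; apply/negP => lt_a; apply: nex; exists n; exact: ltW.
(* Multiplying this inequality by [m ^ d] gives [((2d+1) m)^d < (m e)^(d+1)]. Positivity of [m]
   serves to bound [(d+1) m + d] by [(2d+1) m]. *)
have [m m0 lt_m] :
    exists2 m, (0 < m)%N & (d.*2.+1 ^ d)%:R < m%:R * e ^+ d.+1 :> R.
  exists (Num.bound ((d.*2.+1 ^ d)%:R / e ^+ d.+1)).+1 => //.
  rewrite -ltr_pdivrMr ?exprn_gt0//; apply: lt_le_trans (archi_boundP _) _.
    by rewrite divr_ge0 ?ler0n ?exprn_ge0// ltW.
  by rewrite ler_nat.
have : (1 + e) ^+ (d.+1 * m) <= ((d.*2.+1 * m) ^ d)%:R.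
  apply: le_trans (grow _) _; apply: (@le_trans _ _ ((d.+1 * m + d) ^ d)%:R).
    by rewrite ler_nat.
  rewrite !natrX lerXn2r ?nnegrE ?ler0n// ler_nat -addnn -addnS mulnDl addnC.
  by rewrite leq_add2r leq_pmulr.
apply/negP; rewrite -ltNge; apply: (@lt_le_trans _ _ ((m%:R * e) ^+ d.+1)).
  rewrite expnMn natrM exprMn exprSr -mulrA mulrC natrX.
  by rewrite ltr_pM2l// exprn_gt0// ltr0n.
have em0 : 0 <= (1 + e) ^+ m by rewrite exprn_ge0// addr_ge0// ltW.
rewrite mulnC exprM lerXn2r ?nnegrE// ?mulr_ge0 ?ler0n ?(ltW e0)//.
by apply: le_trans (bernoulli _ (ltW e0)); rewrite mulr_natl lerDr ler01.
Qed.

End SubexponentialGrowth.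

(** * Amenability of countable FC-groups *)

Section Folner.
Variables (R : realType) (G : groupType).
Hypothesis G_FC : FC_group G.

Lemma FC_almost_invariant (K : set G) (e : R) : finite_set K -> 0 < e ->
  exists2 Phi : {fset G}, Phi != fset0 & forall g, K g ->
    1 - e <= #|` (Phi `&` [fset (x * g)%g | x in Phi])%fset |%:R / #|` Phi|%:R.
Proof.
move=> finK e0.
(* The letter 1 makes words of length [n] also words of length [n+1], and keeps the alphabet
   nonempty. *)
have [E finE [KE EJ]] : exists2 E : set G, finite_set E &
    K `|` [set 1%g] `<=` E /\ forall g x, E g -> E (g ^ x)%g.
  by apply: FC_conj_closure => //; rewrite finite_setU; split=> //; exact: finite_set1.
have [r [k defE]] : exists r (k : 'I_r.+1 -> G), E = range k.
  have E1 : E 1%g by apply: KE; right.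
  move: finE => /finite_fsetP[X defE]; rewrite {}defE in E1 *.
  have X0 : (0 < #|` X|)%N by rewrite cardfs_gt0; apply/fset0Pn; exists 1%g.
  exists #|` X|.-1, (fun i => nth 1%g X i); apply/seteqP; split=> g.
    move=> Xg; have := Xg; rewrite /= -index_mem -[X in (_ < X)%N](prednK X0) => lti.
    by exists (Ordinal lti) => //=; rewrite nth_index.
  by move=> [i _ <-] /=; rewrite mem_nth// -[X in (_ < X)%N](prednK X0).
have kJ i j : exists l, k l = (k i ^ k j)%g.
  have : E (k i ^ k j)%g by apply: EJ; rewrite defE; exists i.
  by rewrite defE => -[l]; exists l.
pose B := words_of_length k.
have B0 n : (0 < #|` B n|)%N by rewrite cardfs_gt0 words_of_length_neq0.
have [n leB] := polynomial_growth_ratio e0 (B0 0) (leq_card_words kJ).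
have kB g h : E g -> h \in B n -> (h * g)%g \in B n.+1.
  by rewrite defE => -[i _ <-]; exact: words_of_lengthMr.
exists (B n) => [|g Kg]; first exact: words_of_length_neq0.
(* Since [B n] and its translate have equal size, bounding their union by
   [|B n.+1| <= (1 + e) |B n|] leaves an intersection of size at least [(1 - e) |B n|]. *)
have sub : (B n `|` [fset (x * g)%g | x in B n] `<=` B n.+1)%fset.
  apply/fsubsetP => x /fsetUP[Bx|/imfsetP[y By ->]].
    by rewrite -[x]mulg1; apply: kB => //; apply: KE; right.
  by apply: kB => //; apply: KE; left.
set C := [fset (x * g)%g | x in B n]%fset in sub *.
have cardC : #|` C| = #|` B n| by rewrite card_imfset//; exact: mulIg.
have := fsubset_leq_card sub; rewrite -(leq_add2r #|` (B n `&` C)%fset|).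
rewrite cardfsUI cardC -(ler_nat R) !natrD => leUI.
rewrite ler_pdivlMr ?ltr0n// mulrBl mul1r lerBlDr -(lerD2l #|` B n|%:R).
apply: le_trans leUI _; rewrite [leRHS]addrCA [leLHS]addrC lerD2l.
by apply: le_trans leB _; rewrite mulrDl mul1r.
Qed.

(** An injection [f] into the naturals exhausts [G] by finite sets; the [n]-th Folner set has error
    [1/(n+1)] on the elements with [f g < n], which eventually include any given [g]. *)
Lemma FC_amenable : countable [set: G] -> amenable R G.
Proof.
move=> /countable_injP[f /in2TT f_inj].
have finK n : finite_set [set g | (f g < n)%N].
  apply: (@finite_preimage _ _ `I_n).
    by move=> x y _ _; exact: f_inj.
  exact: finite_II.
have e0 n : 0 < harmonic n :> R by rewrite /harmonic /= invr_gt0 ltr0n.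
have /choice[Phi PhiP] n : exists Phi : {fset G}, Phi != fset0 /\ forall g,
    (f g < n)%N -> 1 - harmonic n <=
      #|` (Phi `&` [fset (x * g)%g | x in Phi])%fset |%:R / #|` Phi|%:R :> R.
  by have [Phi] := FC_almost_invariant (finK n) (e0 n); exists Phi.
exists Phi; split=> [n|g]; first by have [] := PhiP n.
apply: (@squeeze_cvgr _ _ _ _ (fun n => 1 - harmonic n) (fun=> 1)).
- near=> n; have [Phi0 ->] := PhiP n; last by near: n; exact: nbhs_infty_gt.
  rewrite /= ler_pdivrMr ?mul1r ?ler_nat ?ltr0n ?cardfs_gt0//.
  exact/fsubset_leq_card/fsubsetIl.
- rewrite -[X in _ --> X]subr0; apply: cvgB; first exact: cvg_cst.
  exact: cvg_harmonic.
- exact: cvg_cst.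
Unshelve. all: by end_near. Qed.

End Folner.

Theorem theorem22 (R : realType) (G : groupType)
    (G_countable : countable [set: G]) (G_FC : FC_group G) :
  (forall m : nat, (1 <= m)%N ->
     right_vdW [set A : set {ffun 'I_m -> G} | left_piecewise_syndetic A]) /\
  (right_vdW_group R G /\ left_vdW_group R G).
Proof.
have vdW m : right_vdW [set A : set {ffun 'I_m -> G} | left_piecewise_syndetic A].
  exact/FC_left_pws_right_vdW/FC_ffun.
have amG : amenable R G by exact: FC_amenable.
split=> [m _ //|]; split; split=> // m; first by eexists; exact: vdW.
(* The left family consists of the sets whose inverse is left piecewise syndetic. *)
by eexists; exact: setV_left_vdW (vdW m).
Qed.
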